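(* Let $D_n$ be the dihedral group of order $2n$. For $G=D_{n}$ we have $$\mathcal{F}_{G}= \begin{cases} \mathcal{F}_{\mathbb{Z}/n}+1 & \text{if } n \text{ is odd},\\ \mathcal{F}_{\mathbb{Z}/n}+2 & \text{otherwise.}\end{cases}$$
   Context: For a group $G$, $G^{fin}$ is the set of finite order elements. For $g\in G^{fin}$ of order $d$, $p_g=\frac{1+g+\cdots+g^{d-1}}{d}\in\mathbb{C}G$. The equivalence relation $\sim_{\mathrm{fin}}$ on $G^{fin}$: $g\sim_{\mathrm{fin}}h$ if and only if there is $\gamma\in G$ with $p_g=\gamma p_h\gamma^{-1}$; equivalently, $g$ and $h$ have the same order and some power $g^a$, $a\in\mathbb{N}$, is conjugate to $h$. $\mathcal{F}_G:=|G^{fin}/_{\sim_{\mathrm{fin}}}|$. $D_n$ is generated by $x,y$ with relations $x^2=y^n=(xy)^2=1$. *)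

(* Defs.v *)
From mathcomp Require Import all_boot all_order all_fingroup all_algebra.
From mathcomp Require Import all_solvable all_field all_character.
From mathcomp Require Import boolp reals complex.

Set Implicit Arguments.
Unset Strict Implicit.
Unset Printing Implicit Defensive.

Import GroupScope GRing.Theory.

(* The group algebra C[G] is MathComp's [group_ring C G]: the algebra spanned
   by the matrices [regular_repr C G x], x \in G, of the (faithful) regular
   representation. The element x of G, seen in C[G], is [regular_repr C G x]. *)
Section FiniteOrderClasses.

Variables (C : fieldType) (gT : finGroupType) (G : {group gT}).

(* This is all of G, since G is finite. *)
Definition fin_elts : {set gT} :=
  [set g in G | `[< exists2 d : nat, (0 < d)%N & g ^+ d = 1 >]].

Definition fin_proj (g : gT) : 'M[C]_(gcard G) :=
  ((#[g]%:R)^-1 *: \sum_(i < #[g]) regular_repr C G (g ^+ i)%g)%R.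

Definition fin_sim (g h : gT) : bool :=
  [exists gamma in G,
     fin_proj g ==
       (regular_repr C G gamma *m fin_proj h *m regular_repr C G (gamma^-1)%g)%R].

Definition fin_classes : nat := #|equivalence_partition fin_sim fin_elts|.

Lemma fin_sim_equiv : equivalence_rel fin_sim.
Proof.
have reprV x : x \in G ->
    (regular_repr C G (x^-1)%g *m regular_repr C G x = 1%:M)%R.
  by move=> Gx; rewrite -repr_mxM ?groupV // mulVg repr_mx1.
have refl : reflexive fin_sim.
  move=> g; apply/existsP; exists 1.
  by rewrite group1 invg1 repr_mx1 mul1mx mulmx1 eqxx.
have sym g h : fin_sim g h -> fin_sim h g.
  case/existsP=> c /andP[Gc /eqP e]; apply/existsP; exists c^-1.
  by rewrite groupV Gc e invgK !mulmxA reprV // mul1mx -mulmxA reprV // mulmx1 /=.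
have trans g h k : fin_sim g h -> fin_sim h k -> fin_sim g k.
  case/existsP=> c /andP[Gc /eqP e]; case/existsP=> b /andP[Gb /eqP f].
  apply/existsP; exists (c * b); rewrite groupM //= e f invMg.
  by rewrite !repr_mxM ?groupV // !mulmxA eqxx.
move=> g h k; split=> // gh; apply/idP/idP; last exact: trans.
by apply: trans; apply: sym.
Qed.

End FiniteOrderClasses.

Arguments fin_elts {gT} G%_G.
Arguments fin_proj C {gT} G%_G g.
Arguments fin_sim C {gT} G%_G g h.
Arguments fin_classes C {gT} G%_G.

(* Main.v *)
Require Import Defs.
From mathcomp Require Import all_boot all_order all_fingroup all_algebra.
From mathcomp Require Import all_solvable all_field all_character.
From mathcomp Require Import boolp reals complex zify.

Set Implicit Arguments.
Unset Strict Implicit.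
Unset Printing Implicit Defensive.

Import GroupScope GRing.Theory.

(** In characteristic zero the idempotent p_g determines, and is determined by,
    the cyclic subgroup <[g]>: its coefficients on the basis G of the group
    algebra are 1/#[g] on <[g]> and 0 elsewhere. Conjugating p_g by c gives the
    idempotent of a conjugate of g, so g and h are equivalent exactly when the
    subgroups <[g]> and <[h]> are conjugate in G, and F_G counts the conjugacy
    classes of cyclic subgroups of G ([fin_classesE]).

    Let now G be dihedral, with Y = <[y]> its rotation subgroup, of order n.
    Rotations and reflections do not mix, since Y is normal
    ([disjoint_rotation_reflection_classes]).

    Every subgroup of Y is normal in G, because Y is abelian and x inverts it.
    So the rotations contribute one class for each cyclic subgroup of Y, and
    as Y is isomorphic to Z/n this is F_(Z/n) ([card_rotation_classes],
    [card_cycles_isog]).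

    Each reflection x * z, with z in Y, has order 2, so two reflections are
    equivalent exactly when they are conjugate. Conjugating by a rotation w
    changes z into z * w ^+ 2 ([reflection_conj]), so only the parity of the
    exponent of y matters, and the reflections contribute the classes of x and
    x * y. These are the same class if and only if y is a square in Y, that is,
    if and only if n is odd ([eq_reflection_classes]).

    The counting uses that x and y have orders exactly 2 and n and generate
    subgroups with trivial intersection. The relations bound |G| above by 2n;
    the presentation being universal, a concrete group of order 2n satisfying
    the same relations is a quotient of G and bounds |G| below
    ([dihedral_order]). *)

(** * Conjugacy classes of cyclic subgroups *)

(** The image of a map is in bijection with the set of its fibers, so maps with
    the same fibers have images of the same size. *)
Lemma card_imset_fibers (T U V : finType) (A : {set T}) (f : T -> U)
    (h : T -> V) :
    {in A &, forall x y, (f x == f y) = (h x == h y)} ->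
  #|[set f x | x in A]| = #|[set h x | x in A]|.
Proof.
have le (W1 W2 : finType) (f1 : T -> W1) (f2 : T -> W2) :
    {in A &, forall x y, (f1 x == f1 y) = (f2 x == f2 y)} ->
    #|[set f1 x | x in A]| <= #|[set f2 x | x in A]|.
  move=> eq12; have [->|[x0 Ax0]] := set_0Vmem A.
    by rewrite !imset0 !cards0.
  (* s sends f2 x to f1 x, because f1 is constant on the fibers of f2. *)
  pose s w := f1 (odflt x0 [pick x in A | f2 x == w]).
  apply: leq_trans (leq_imset_card s _).
  apply/subset_leq_card/subsetP=> _ /imsetP[x Ax ->].
  apply/imsetP; exists (f2 x); first exact: imset_f.
  rewrite /s; case: pickP => [y /andP[Ay eqy] | /(_ x)] /=.
    by apply/eqP; rewrite eq_sym eq12.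
  by rewrite Ax eqxx.
by move=> eq_fh; apply/eqP; rewrite eqn_leq !le // => x y Ax Ay; rewrite eq_fh.
Qed.

Definition cycle_class (gT : finGroupType) (G : {group gT}) (g : gT) :=
  <[g]> :^: G.

Lemma cycle_class_eq (gT : finGroupType) (G : {group gT}) (g h : gT) :
  (cycle_class G g == cycle_class G h)
    = [exists c in G, <[g]> == <[h ^ c]> ].
Proof.
rewrite /cycle_class -!orbitJs; apply/eqP/idP => [eq_gh | ].
  have /imsetP[c Gc ->] : <[g]> \in orbit 'Js G <[h]>.
    by rewrite -eq_gh orbit_refl.
  by apply/existsP; exists c; rewrite Gc cycleJ /=.
case/existsP=> c /andP[Gc /eqP eqgh]; apply/orbit_eqP.
by rewrite eqgh cycleJ; apply/imsetP; exists c.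
Qed.

(** * The idempotents attached to elements of finite order *)

Section Projections.

Variables (F : numFieldType) (gT : finGroupType) (G : {group gT}).

Lemma fin_projE g :
  fin_proj F G g = ((#[g]%:R)^-1 *: \sum_(z in <[g]>) regular_repr F G z)%R.
Proof.
have -> : <[g]> = [set g ^+ i | i : 'I_#[g]].
  apply/setP=> z; apply/idP/imsetP => [/cyclePmin[i lti ->] | [i _ ->]].
    by exists (Ordinal lti).
  exact: mem_cycle.
rewrite big_imset //= => i j _ _ /eqP.
by rewrite eq_expg_ord // => /eqP.
Qed.

(** The elements of G are linearly independent in the regular representation, so
    the coefficient of z in p_g can be read off from the sum over <[g]>. *)
Lemma gring_proj_fin_projE g z : g \in G -> z \in G ->
  gring_proj z (fin_proj F G g) = ((#[g]%:R)^-1 *: (z \in <[g]>)%:R)%R.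
Proof.
move=> Gg Gz; rewrite fin_projE linearZ linear_sum /=; congr (_ *: _)%R.
have sgG : <[g]> \subset G by rewrite cycle_subG.
under eq_bigr => u gu do rewrite gring_projE ?(subsetP sgG u gu) //.
have [gz | g'z] := boolP (z \in <[g]>).
  rewrite (bigD1 z) //= eqxx big1 ?addr0 // => u /andP[_].
  by rewrite eq_sym => /negPf->.
by apply: big1 => u gu; case: eqP => // eq_zu; rewrite eq_zu gu in g'z.
Qed.

(** The support of p_g is <[g]>: this is where characteristic zero is used, to
    know that 1/#[g] is not zero. *)
Lemma eq_fin_proj g h : g \in G -> h \in G ->
  (fin_proj F G g == fin_proj F G h) = (<[g]> == <[h]>).
Proof.
move=> Gg Gh; apply/eqP/eqP=> [eq_p | eq_c]; last first.
  by rewrite !fin_projE eq_c /order eq_c.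
have coefE (k z : gT) : k \in G -> z \in G ->
    (gring_proj z (fin_proj F G k) == 0%R) = (z \notin <[k]>).
  move=> Gk Gz; rewrite gring_proj_fin_projE //.
  rewrite scaler_eq0 invr_eq0 Num.Theory.pnatr_eq0 -leqn0 leqNgt order_gt0 /=.
  by case: (z \in _); rewrite ?oner_eq0 ?eqxx.
apply/setP=> z; have [Gz | notGz] := boolP (z \in G).
  by apply: negb_inj; rewrite -!coefE // eq_p.
have notin k : k \in G -> (z \in <[k]>) = false.
  by move=> Gk; apply: contraNF notGz => kz; rewrite (subsetP _ z kz) ?cycle_subG.
by rewrite !notin.
Qed.

Lemma fin_projJ h c : h \in G -> c \in G ->
  (regular_repr F G c *m fin_proj F G h *m regular_repr F G (c^-1)%g)%R
    = fin_proj F G (h ^ c^-1).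
Proof.
move=> Gh Gc; rewrite /fin_proj orderJ -scalemxAr -scalemxAl.
rewrite mulmx_sumr mulmx_suml; congr (_ *: _)%R; apply: eq_bigr => i _.
by rewrite -!repr_mxM ?groupM ?groupV ?groupX // -conjXg conjgE invgK mulgA.
Qed.

Lemma fin_sim_cycle_class g h : g \in G -> h \in G ->
  fin_sim F G g h = (cycle_class G g == cycle_class G h).
Proof.
move=> Gg Gh; rewrite cycle_class_eq /fin_sim; apply/existsP/existsP.
  case=> c /andP[Gc]; rewrite fin_projJ // eq_fin_proj ?groupJ ?groupV // => e.
  by exists c^-1; rewrite groupV Gc.
case=> c /andP[Gc e]; exists c^-1; rewrite groupV Gc fin_projJ ?groupV //.
by rewrite invgK eq_fin_proj ?groupJ.
Qed.

Lemma fin_eltsE : fin_elts G = G.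
Proof.
apply/setP=> g; rewrite inE; case Gg: (g \in G) => //=; apply/asboolP.
by exists #[g]; [exact: order_gt0 | exact: expg_order].
Qed.

(** The relation has the same fibers as the map sending g to the conjugacy class
    of <[g]>, so its equivalence classes are counted by the image of that map. *)
Lemma fin_classesE : fin_classes F G = #|[set cycle_class G g | g in G]|.
Proof.
rewrite /fin_classes fin_eltsE; apply: card_imset_fibers => g h Gg Gh.
rewrite -fin_sim_cycle_class //; have eqR := @fin_sim_equiv F _ G.
apply/eqP/idP => [/setP/(_ h) | gh].
  by rewrite !inE Gh /= => ->; case: (eqR h h h).
apply/setP=> k; rewrite !inE; congr (_ && _).
by case: (eqR g h k) => _; apply.
Qed.

End Projections.

(** * Abelian groups *)

Lemma cycle_class_normal (gT : finGroupType) (G : {group gT}) (g : gT) :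
  G \subset 'N(<[g]>) -> cycle_class G g = [set <[g]> ].
Proof.
move=> nGg; rewrite /cycle_class -orbitJs; apply/orbit1P/afixP=> c Gc /=.
exact: (normsP nGg).
Qed.

Lemma card_cycles_isog (aT rT : finGroupType) (A : {group aT})
    (B : {group rT}) :
  A \isog B -> #|[set <[g]> | g in A]| = #|[set <[g]> | g in B]|.
Proof.
case/isogP=> f injf <-; rewrite morphimEdom -imset_comp.
apply: card_imset_fibers => g h Ag Ah /=.
rewrite -!morphim_cycle //; apply/eqP/eqP => [-> // |].
by apply: injm_morphim_inj; rewrite ?cycle_subG.
Qed.

Lemma fin_classes_abelian (F : numFieldType) (gT : finGroupType)
    (A : {group gT}) :
  abelian A -> fin_classes F A = #|[set <[g]> | g in A]|.
Proof.
move=> cAA; rewrite fin_classesE; apply: card_imset_fibers => g h Ag Ah.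
by rewrite !cycle_class_normal ?(inj_eq set1_inj) ?sub_abelian_norm ?cycle_subG.
Qed.

Lemma Zp_cyclic n : cyclic (Zp n).
Proof.
rewrite /Zp; case: ifP => _; last exact: cyclic1.
by rewrite Zp_cycle cycle_cyclic.
Qed.

(** * Rotations and reflections *)

Lemma cycle_classJ (gT : finGroupType) (G : {group gT}) (g c : gT) :
  c \in G -> cycle_class G (g ^ c) = cycle_class G g.
Proof.
move=> Gc; apply/eqP; rewrite cycle_class_eq.
by apply/existsP; exists c; rewrite Gc /=.
Qed.

Section Dihedral.

Variables (gT : finGroupType) (G : {group gT}) (x y : gT).
Hypotheses (defG : <[x]> * <[y]> = G) (ox : #[x] = 2).
Hypotheses (invy : y ^ x = y^-1) (Y'x : x \notin <[y]>).

Let sYG : <[y]> \subset G.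
Proof. by rewrite -defG mulG_subr. Qed.

Lemma rotation_conj w : w \in <[y]> -> w ^ x = w^-1.
Proof. by case/cycleP=> i ->; rewrite conjXg invy expgVn. Qed.

(** Moving w^-1 past x inverts it, so both factors w end up on the right of x,
    where everything commutes. *)
Lemma reflection_conj z w : z \in <[y]> -> w \in <[y]> ->
  (x * z) ^ w = x * (z * w ^+ 2).
Proof.
move=> Yz Yw; have cwz : commute w z by apply: (centsP (cycle_abelian y)).
rewrite conjgE !mulgA [w^-1 * x]conjgC rotation_conj ?groupV // invgK.
by rewrite -!mulgA; congr (x * _); rewrite [w * _]mulgA cwz -mulgA.
Qed.

Lemma reflection_order z : z \in <[y]> -> #[x * z] = 2.
Proof.
move=> Yz; apply: nt_prime_order => //.
  have x2 : x * x = 1 by rewrite -[x * x]/(x ^+ 2) -ox expg_order.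
  rewrite expgS expg1 -mulgA [z * _]mulgA [z * x]conjgC rotation_conj //.
  by rewrite -mulgA mulVg mulg1.
apply: contra Y'x => /eqP xz1.
by rewrite -(mulgK z x) xz1 mul1g groupV.
Qed.

Lemma cycle_class_rotation g : g \in <[y]> -> cycle_class G g = [set <[g]> ].
Proof.
move=> Yg; apply: cycle_class_normal; rewrite -defG mul_subG //.
  by rewrite cycle_subG inE -cycleJ rotation_conj // cycleV.
by rewrite sub_abelian_norm ?cycle_abelian ?cycle_subG.
Qed.

Lemma card_rotation_classes :
  #|[set cycle_class G g | g in <[y]> ]| = #|[set <[g]> | g in <[y]> ]|.
Proof.
apply: card_imset_fibers => g h Yg Yh.
by rewrite !cycle_class_rotation // (inj_eq set1_inj).
Qed.

Lemma reflectionsE : G :\: <[y]> = [set x * z | z in <[y]> ].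
Proof.
apply/setP=> g; rewrite !inE -defG; apply/andP/imsetP => [[Y'g] | [z Yz ->]].
  case/mulsgP=> u z; rewrite cycle2g // !inE => /pred2P[] -> Yz def_g.
    by rewrite def_g mul1g Yz in Y'g.
  by exists z.
by rewrite groupMr // Y'x mem_mulg ?cycle_id.
Qed.

(** The class of a rotation g is the singleton of the normal subgroup <[g]>; a
    reflection h in the same class would generate <[g]>, hence lie in <[y]>. *)
Lemma disjoint_rotation_reflection_classes :
  [disjoint [set cycle_class G g | g in <[y]> ]
          & [set cycle_class G g | g in G :\: <[y]> ]].
Proof.
apply/pred0P=> K /=; apply/andP=> [[/imsetP[g Yg ->] /imsetP[h]]].
rewrite inE => /andP[Y'h _] /eqP; rewrite eq_sym.
rewrite (cycle_class_rotation Yg) => /eqP hg.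
have: <[h]> \in cycle_class G h by apply/imsetP; exists 1; rewrite ?conjsg1.
rewrite hg inE => /eqP gh; case/negP: Y'h.
by rewrite -cycle_subG gh cycle_subG.
Qed.

Lemma cycle_class_reflection_square z w : z \in <[y]> -> w \in <[y]> ->
  cycle_class G (x * (z * w ^+ 2)) = cycle_class G (x * z).
Proof.
by move=> Yz Yw; rewrite -reflection_conj // cycle_classJ // (subsetP sYG).
Qed.

(** An exponent i is its parity plus an even number, and y to an even power is
    the square of a rotation. *)
Lemma cycle_class_reflection i :
  cycle_class G (x * y ^+ i) = cycle_class G (x * y ^+ odd i).
Proof.
rewrite -{1}(odd_double_half i) expgD -muln2 expgM.
by rewrite cycle_class_reflection_square ?mem_cycle.
Qed.

Lemma reflection_classesE :
  [set cycle_class G g | g in G :\: <[y]> ]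
    = [set cycle_class G x; cycle_class G (x * y)].
Proof.
rewrite reflectionsE -imset_comp; apply/setP=> K; rewrite !inE.
apply/imsetP/pred2P => [[_ /cycleP[i ->] ->] | [] ->] /=.
- by rewrite cycle_class_reflection; case: odd; rewrite ?mulg1; [right | left].
- by exists 1; rewrite //= mulg1.
by exists y; rewrite ?cycle_id.
Qed.

(** If x and x * y are conjugate then y = w ^+ 2 for a rotation w = y ^+ j, so
    that 1 and 2j agree modulo the order of y, which must be odd. Conversely, if
    that order m is odd then y = y ^+ m.+1 is an even power of y. *)
Lemma eq_reflection_classes :
  (cycle_class G x == cycle_class G (x * y)) = odd #[y].
Proof.
apply/idP/idP=> [|odd_y].
  rewrite cycle_class_eq => /existsP[c /andP[Gc /eqP eqc]].
  (* A subgroup of order 2 has only one nontrivial element. *)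
  have {eqc} def_x : x = (x * y) ^ c.
    have : x \in <[(x * y) ^ c]> by rewrite -eqc cycle_id.
    rewrite cycle2g ?orderJ ?reflection_order ?cycle_id // !inE.
    by rewrite -order_eq1 ox => /eqP.
  have [w Yw def_y] : exists2 w, w \in <[y]> & y = w ^+ 2.
    move: Gc def_x; rewrite -defG => /mulsgP[u w].
    rewrite cycle2g // !inE => /pred2P[] -> Yw ->.
      rewrite mul1g reflection_conj ?cycle_id // -{1}[x]mulg1 => /mulgI yw.
      exists w^-1; rewrite ?groupV // expgVn; apply: (mulIg (w ^+ 2)).
      by rewrite -yw mulVg.
    have xx : x ^ x = x by rewrite conjgE mulKg.
    rewrite conjgM [(x * y) ^ x]conjMg invy xx.
    rewrite reflection_conj ?groupV ?cycle_id // -{1}[x]mulg1 => /mulgI yw.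
    by exists w => //; apply: (mulgI y^-1); rewrite -yw mulVg.
  case/cycleP: Yw => j def_w; move/eqP: def_y.
  rewrite def_w -expgM -{1}[y]expg1 eq_expg_mod_order => /eqP e.
  apply: contraT => ev; have: odd (1 %% #[y]) = odd (j * 2 %% #[y]) by rewrite e.
  by rewrite !odd_mod ?(negPf ev) // oddM andbF.
apply/eqP; have -> : x * y = x * y ^+ #[y].+1 by rewrite expgS expg_order mulg1.
by rewrite cycle_class_reflection /= odd_y mulg1.
Qed.

End Dihedral.

(** * Generators of a dihedral group *)

(** Every group satisfying the relations is a quotient of G, so one such group
    of order 2n suffices. As 'D_(2n) is dihedral of order 2n only from n = 2
    on, for n = 1 the witness is Z/2, generated by x, with y trivial. *)
Lemma dihedral_order (gT : finGroupType) (G : {group gT}) n : 0 < n ->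
  G \isog Grp (x : y : x ^+ 2, y ^+ n, (x * y) ^+ 2) -> n.*2 <= #|G|.
Proof.
move=> n_gt0 isoG.
suff [rT [H oH homH]] : exists (rT : finGroupType),
    exists2 H : {group rT}, #|H| = n.*2
      & H \homg Grp (x : y : x ^+ 2, y ^+ n, (x * y) ^+ 2).
  by rewrite -oH; apply: leq_homg; rewrite isoG.
case: n n_gt0 isoG => [|[|n]] // _ _.
  exists 'Z_2, [set: 'Z_2]%G; first by rewrite cardsT card_ord.
  have genZ : <[Zp1 : 'Z_2]> = [set: 'Z_2] by rewrite -Zp_cycle.
  have Zp1_2 : (Zp1 : 'Z_2) ^+ 2 = 1 by apply/eqP; rewrite -order_dvdn order_Zp1.
  apply/existsP; exists (Zp1 : 'Z_2, 1).
  apply/eqP; congr (_, (_, (_, _))) => //=; last by rewrite mulg1.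
  by rewrite cycle1 joingG1.
exists _, 'D_(n.+2.*2)%G; first exact: card_dihedral.
have := isoGrp_hom (Grp_dihedral (isT : 1 < n.+2)).
case/existsP=> [[y x]] /= /eqP[defD yn x2 yx]; apply/existsP; exists (x, y).
rewrite /= !xpair_eqE -defD joingC eqxx x2 yn eqxx /=.
rewrite expgS expg1 mulgA -[x * y * x]mulgA [y * x]conjgC yx mulgA.
by rewrite -(expgS x 1) x2 mul1g mulVg.
Qed.

(** Here #[x] <= 2 and #[y] <= n, while #[x] * #[y] is |G| times the order of the
    intersection of <[x]> and <[y]>. As |G| >= 2n, equality holds throughout. *)
Lemma dihedral_generators (gT : finGroupType) (G : {group gT}) n : 0 < n ->
    G \isog Grp (x : y : x ^+ 2, y ^+ n, (x * y) ^+ 2) ->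
  exists x y, [/\ <[x]> * <[y]> = G, #[x] = 2, #[y] = n, y ^ x = y^-1
                & x \notin <[y]> ].
Proof.
move=> n_gt0 isoG; have leG := dihedral_order n_gt0 isoG.
have /existsP[[x y] /= /eqP[defG x2 yn xy2]] := isoGrp_hom isoG.
have invx : x^-1 = x by apply/eqP; rewrite eq_invg_mul -[x * x]/(x ^+ 2) x2.
have yx : y ^ x = y^-1.
  have xyxy : x * y * x * y = 1 by rewrite -mulgA.
  apply: (mulgI y); rewrite mulgV conjgE invx; apply: (mulgI x).
  by rewrite !mulgA xyxy mul1g mulg1.
exists x, y.
have {}defG : <[x]> * <[y]> = G.
  by rewrite -defG norm_joinEl // cycle_subG inE -cycleJ yx cycleV.
have lex : #[x] <= 2 by rewrite dvdn_leq // order_dvdn x2.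
have ley : #[y] <= n by rewrite dvdn_leq // order_dvdn yn.
have card_xy : (#[x] * #[y] = #|G| * #|<[x]> :&: <[y]>|)%N.
  by have := mul_cardG <[x]> <[y]>; rewrite defG.
have I_gt0 : 0 < #|<[x]> :&: <[y]>| by apply: cardG_gt0.
have leGI := leq_pmulr #|G| I_gt0.
have [ox oy] : #[x] = 2 /\ #[y] = n.
  have le2xy : n.*2 <= #[x] * #[y] by rewrite card_xy (leq_trans leG).
  by move: lex; case: #[x] le2xy => [|[|[|]]] //; lia.
have oI : #|<[x]> :&: <[y]>| = 1%N.
  apply/eqP; rewrite -(eqn_pmul2l (cardG_gt0 G)) muln1 eqn_leq leGI andbT.
  by rewrite -card_xy ox oy mul2n.
split=> //; apply/negP=> Yx; have := oI.
by rewrite (setIidPl _) ?cycle_subG // -orderE ox.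
Qed.

Theorem proposition5p12 (R : realType) (n : nat) (gT : finGroupType)
    (G : {group gT}) (n_gt0 : (0 < n)%N)
    (dihedralG : G \isog Grp (x : y : x ^+ 2, y ^+ n, (x * y) ^+ 2)) :
  fin_classes (complex R) G =
    (if odd n then fin_classes (complex R) (Zp n) + 1
     else fin_classes (complex R) (Zp n) + 2)%N.
Proof.
have [x [y [defG ox oy yx Y'x]]] := dihedral_generators n_gt0 dihedralG.
have isoY : <[y]> \isog Zp n.
  by rewrite isog_cyclic_card ?cycle_cyclic // Zp_cyclic card_Zp // -orderE oy /=.
rewrite fin_classesE fin_classes_abelian ?cyclic_abelian ?Zp_cyclic //.
rewrite -(card_cycles_isog isoY).
have sYG : <[y]> \subset G by rewrite -defG mulG_subr.
rewrite -{1}(setID G <[y]>) (setIidPr sYG) imsetU cardsU.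
rewrite (disjoint_setI0 (disjoint_rotation_reflection_classes defG yx)).
rewrite cards0 subn0 (card_rotation_classes defG yx).
rewrite (reflection_classesE defG ox yx Y'x) cards2.
by rewrite (eq_reflection_classes defG ox yx Y'x) oy; case: odd.
Qed.
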